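(* Let $\mathcal{H}$ be a complex Hilbert space and let $A\in\mathcal{B}(\mathcal{H})$. Then $$\frac14\|A^*A+AA^*\|\le\frac18\left[\max\left\{\|A+A^*\|^2,\|A-A^*\|^2\right\}+\|A+A^*\|\|A-A^*\|\right]\le w^2(A).$$
   Context: $\mathcal{B}(\mathcal{H})$ is the set of bounded linear operators on $\mathcal{H}$, $A^*$ is the adjoint of $A$, and $\|\cdot\|$ is the operator norm. The numerical radius is $w(A)=\sup\{|\langle Ax,x\rangle| : x\in\mathcal{H},\ \|x\|=1\}$, and $w^2(A)=(w(A))^2$. *)

(* Defs.v *)
From HB Require Import structures.
From mathcomp Require Import all_boot all_order all_algebra.
From mathcomp Require Import complex.
From mathcomp Require Import all_classical all_reals topology normedtype.

Set Implicit Arguments.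
Unset Strict Implicit.
Unset Printing Implicit Defensive.

Import Order.TTheory GRing.Theory Num.Theory.
Import numFieldNormedType.Exports.

Local Open Scope classical_set_scope.
Local Open Scope complex_scope.
Local Open Scope ring_scope.

(* The dot forms of sesquilinear.v are linear in the first argument and
   conjugate-linear in the second one. *)
HB.mixin Record CompleteNormedModule_isHilbert (R : realType) H
    of CompleteNormedModule R[i] H := {
  inner : {dot H for (@Num.conj R[i])} ;
  sqr_norm_inner : forall x : H, `|x| ^+ 2 = inner x x
}.

#[short(type="hilbertType")]
HB.structure Definition Hilbert (R : realType) :=
  { H of CompleteNormedModule R[i] H & CompleteNormedModule_isHilbert R H }.

Arguments inner {R s}.

Section BoundedOperators.
Context {R : realType} {H : hilbertType R}.

(* The norm of a normed module over R[i] takes its values in R[i]; they are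
   real, and hnorm reads them in R. *)
Definition hnorm (x : H) : R := complex.Re `|x|.

Definition bounded_operator (A : {linear H -> H}) :=
  exists M : R, forall x : H, hnorm (A x) <= M * hnorm x.

(* For a bounded operator A there is exactly one such function B (Riesz), and
   it is itself a bounded linear operator; the default value 0 of xget only
   shows up when A has no adjoint. *)
Definition adjoint (A : H -> H) : H -> H :=
  xget (fun=> 0) [set B | forall x y, inner (A x) y = inner x (B y)].

Definition opnorm (T : H -> H) : R :=
  sup [set hnorm (T x) | x in [set x | hnorm x <= 1]].

(* On the zero space the set is empty and its supremum is 0 by convention. *)
Definition numerical_radius (T : H -> H) : R :=
  sup [set complex.Re `|inner (T x) x| | x in [set x | hnorm x = 1]].

End BoundedOperators.

(* Main.v *)
Require Import Defs.
From mathcomp Require Import all_boot all_order all_algebra.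
From mathcomp Require Import complex.
From mathcomp Require Import all_classical all_reals topology normedtype.
From mathcomp Require Import ring lra.

(* Write A' for the adjoint of A, b = ||A + A'|| and d = ||A - A'||. For ||x||, ||y|| <= 1,
     2 <(A'A + AA')x, y> = <(A + A')x, (A + A')y> + <(A - A')x, (A - A')y>,
   so ||A'A + AA'|| <= (b^2 + d^2) / 2, and b^2 + d^2 <= max(b^2, d^2) + bd.
   Polarization gives |<Ax, y>| + |<Ay, x>| <= 2 w(A), hence b, d <= 2 w(A).

   Riesz' theorem is not needed: if A had no adjoint, [adjoint A] would be the
   zero function, for which b = d = ||A||, and the same polarization estimate
   still yields ||A|| <= 2 w(A). *)

Import Order.TTheory GRing.Theory Num.Theory.

Local Open Scope ring_scope.
Local Open Scope complex_scope.

Section InnerProduct.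
Context {R : realType} {H : hilbertType R}.
Implicit Types (x y z v : H) (K : R[i]).

(* [inner] with R[i] itself as codomain, so that the scalar operations are the
   canonical ones of R[i] and rewriting sees them. *)
Definition dotp x y : R[i] := inner x y.

Lemma dotp0r x : dotp x 0 = 0.
Proof. exact: (linear0r inner). Qed.

Lemma dotpZl (a : R[i]) x y : dotp (a *: x) y = a * dotp x y.
Proof. exact: (linearZl_LR inner). Qed.

Lemma dotpZr (a : R[i]) x y : dotp x (a *: y) = Num.conj a * dotp x y.
Proof. exact: (linearZr_LR inner). Qed.

Lemma dotpDl x y z : dotp (x + y) z = dotp x z + dotp y z.
Proof. exact: (linearDl inner). Qed.

Lemma dotpDr x y z : dotp x (y + z) = dotp x y + dotp x z.
Proof. exact: (linearDr inner). Qed.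

Lemma dotpBl x y z : dotp (x - y) z = dotp x z - dotp y z.
Proof. exact: (linearBl inner). Qed.

Lemma dotpBr x y z : dotp x (y - z) = dotp x y - dotp x z.
Proof. exact: (linearBr inner). Qed.

Lemma dotpC x y : dotp x y = Num.conj (dotp y x).
Proof. by rewrite /dotp hermC expr0 mul1r. Qed.

Lemma sqr_norm_dotp x : `|x| ^+ 2 = dotp x x.
Proof. exact: sqr_norm_inner. Qed.

Lemma norm_dotpC x y : `|dotp x y| = `|dotp y x|.
Proof. by rewrite dotpC norm_conjC. Qed.

(** For nonzero y, the squared norm of |y|^2 x - <x, y> y equals |y|^2 (|x|^2 |y|^2 - |<x, y>|^2),
    so this difference is nonnegative. *)
Lemma dotp_Cauchy_Schwarz x y : `|dotp x y| <= `|x| * `|y|.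
Proof.
have [->|y0] := eqVneq y 0; first by rewrite dotp0r !normr0 mulr0.
rewrite -ler_sqr ?nnegrE ?mulr_ge0// exprMn.
rewrite -(@ler_pM2r _ (`|y| ^+ 2)) ?exprn_gt0 ?normr_gt0// -subr_ge0.
suff -> : `|x| ^+ 2 * `|y| ^+ 2 * `|y| ^+ 2 - `|dotp x y| ^+ 2 * `|y| ^+ 2 =
    `|(`|y| ^+ 2) *: x - dotp x y *: y| ^+ 2 by rewrite exprn_ge0.
rewrite [RHS]sqr_norm_dotp dotpBl !dotpBr !dotpZl !dotpZr /=.
rewrite (dotpC y x) rmorphXn /= (CrealP (normr_real y)) normCK !sqr_norm_dotp.
ring.
Qed.

(** Tested on the unit vector y = v / |v|; if v = 0, the test y = 0 gives 0 <= [K]. *)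
Lemma norm_le_of_dotp v K :
  (forall y, `|y| <= 1 -> `|dotp v y| <= K) -> `|v| <= K.
Proof.
move=> vK; have [->|v0] := eqVneq v 0.
  by move: (vK 0); rewrite dotp0r !normr0; apply.
have nv0 : 0 < `|v| by rewrite normr_gt0.
have := vK (`|v|^-1 *: v).
rewrite normrZ normfV normr_id mulVf ?gt_eqF// => /(_ (lexx _)).
rewrite dotpZr /= -sqr_norm_dotp normrM norm_conjC normfV normrX normr_id.
by rewrite expr2 mulKf ?gt_eqF.
Qed.

(** The parallelogram law, which merges the two bounds that polarization yields at x + y and x -
    y. *)
Lemma sqr_normD_sqr_normB x y :
  `|x + y| ^+ 2 + `|x - y| ^+ 2 = 2 * (`|x| ^+ 2 + `|y| ^+ 2).
Proof.
rewrite !sqr_norm_dotp dotpBl dotpDl !dotpBr !dotpDr; ring.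
Qed.

Lemma norm_Re (z : R[i]) : `|z| = (complex.Re `|z|)%:C.
Proof. exact/esym/RRe_real/normr_real. Qed.

Lemma norm_hnorm x : `|x| = (hnorm x)%:C.
Proof. exact/esym/RRe_real/normr_real. Qed.

Lemma hnorm_le1 x : (hnorm x <= 1) = (`|x| <= 1).
Proof. by rewrite norm_hnorm -lecR. Qed.

End InnerProduct.

Section OperatorNorm.
Context {R : realType} {H : hilbertType R}.
Variables (T : H -> H) (K : R).
Hypothesis TK : forall x, `|x| <= 1 -> `|T x| <= K%:C.

Lemma opnorm_le : opnorm T <= K.
Proof.
apply: ge_sup.
  by exists (hnorm (T 0)), 0 => //=; rewrite hnorm_le1 normr0.
by move=> _ [x /= x1 <-]; rewrite -lecR -norm_hnorm TK// -hnorm_le1.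
Qed.

(** The bound [K] makes the set of norms bounded above, so that its [sup] is a genuine upper
    bound. *)
Lemma le_opnorm x : `|x| <= 1 -> `|T x| <= (opnorm T)%:C.
Proof.
move=> x1; rewrite norm_hnorm lecR; apply: ub_le_sup.
  exists K => _ [z /= z1 <-].
  by rewrite -lecR -norm_hnorm TK// -hnorm_le1.
by exists x => //=; rewrite hnorm_le1.
Qed.

Lemma opnorm_ge0 : 0 <= opnorm T.
Proof.
rewrite -lecR; apply: le_trans (le_opnorm 0 _); first exact: normr_ge0.
by rewrite normr0.
Qed.

End OperatorNorm.

Section NumericalRadius.
Context {R : realType} {H : hilbertType R}.
Variable A : {linear H -> H}.
Hypothesis hA : bounded_operator A.
Local Notation w := (numerical_radius A).

Lemma norm_dotp_numerical_radius (z : H) :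
  `|dotp (A z) z| <= w%:C * `|z| ^+ 2.
Proof.
have [->|z0] := eqVneq z 0; first by rewrite dotp0r !normr0 expr0n mulr0.
have nz0 : 0 < `|z| by rewrite normr_gt0.
suff : `|dotp (A (`|z|^-1 *: z)) (`|z|^-1 *: z)| <= w%:C.
  rewrite linearZ dotpZl dotpZr /= !normrM norm_conjC normfV normr_id.
  by rewrite mulrA -expr2 exprVn ler_pdivrMl ?exprn_gt0// mulrC.
rewrite norm_Re lecR; apply: ub_le_sup.
  (* By Cauchy-Schwarz, a bound [M] for [A] also bounds the numerical range. *)
  have [M AM] := hA; exists M => _ [x /= x1 <-].
  rewrite -lecR -(norm_Re (dotp _ _)).
  apply: le_trans (dotp_Cauchy_Schwarz _ _) _.
  by rewrite (norm_hnorm x) x1 mulr1 norm_hnorm lecR (le_trans (AM x))// x1 mulr1.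
exists (`|z|^-1 *: z) => //=.
by rewrite /hnorm normrZ normfV normr_id mulVf ?gt_eqF.
Qed.

Lemma norm_polarization_le (x y : H) :
  `|dotp (A x) y + dotp (A y) x| <= w%:C * (`|x| ^+ 2 + `|y| ^+ 2).
Proof.
rewrite -(@ler_pM2l _ 2)// mulrCA -sqr_normD_sqr_normB mulrDr.
apply: le_trans (lerD (norm_dotp_numerical_radius _)
                      (norm_dotp_numerical_radius _)).
apply: le_trans (ler_normB _ _).
have -> : dotp (A (x + y)) (x + y) - dotp (A (x - y)) (x - y) =
    2 * (dotp (A x) y + dotp (A y) x).
  by rewrite linearD linearB dotpBl dotpDl !dotpBr !dotpDr; ring.
by rewrite normrM ger0_norm.
Qed.

(* Replacing x by c x multiplies the two inner products by c and by the
   conjugate of c; a suitable unimodular c gives them the same phase. *)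
Lemma norm_dotp_pair_le (x y : H) :
  `|dotp (A x) y| + `|dotp (A y) x| <= w%:C * (`|x| ^+ 2 + `|y| ^+ 2).
Proof.
have phase (z : R[i]) : exists2 a, `|a| = 1 & z = a * `|z|.
  have [->|z0] := eqVneq z 0; first by exists 1; rewrite ?normr1 ?normr0 ?mulr0.
  exists (z / `|z|); last by rewrite divfK ?normr_eq0.
  by rewrite normrM normfV normr_id mulfV ?normr_eq0.
have [a a1 ea] := phase (dotp (A x) y); have [b b1 eb] := phase (dotp (A y) x).
(* The two products get phases c a and conj(c) b, which agree for unimodular c as soon as c^2 =
   conj(a) b. *)
pose c := sqrtC (Num.conj a * b).
have c2 : c ^+ 2 = Num.conj a * b by rewrite sqrtCK.
have c1 : `|c| = 1.
  apply/eqP; rewrite -(@eqrXn2 _ 2)// ?expr1n -?normrX ?c2.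
  by rewrite normrM norm_conjC a1 b1 mul1r.
have aa : a * Num.conj a = 1 by rewrite -normCK a1 expr1n.
have cc : c * Num.conj c = 1 by rewrite -normCK c1 expr1n.
have ecb : Num.conj c * b = c * a.
  rewrite -[b]mul1r -aa -mulrA -c2 expr2.
  by rewrite -[RHS]mul1r -cc; ring.
have := norm_polarization_le (c *: x) y.
rewrite linearZ dotpZl dotpZr /= normrZ c1 mul1r; apply: le_trans.
rewrite {2}ea {2}eb !mulrA ecb -mulrDr normrM normrM c1 a1 !mul1r.
by rewrite ger0_norm// addr_ge0.
Qed.

Lemma numerical_radius_ge0 : 0 <= w.
Proof.
have [[x x0]|noz] := pselect (exists x : H, x != 0).
  have := le_trans (normr_ge0 _) (norm_dotp_numerical_radius x).
  by rewrite pmulr_lge0 ?exprn_gt0 ?normr_gt0// lecR.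
rewrite /numerical_radius; set E := (X in sup X); suff -> : E = set0 by rewrite sup0.
rewrite -subset0 => _ [x /= x1 _]; apply: noz; exists x.
by rewrite -normr_eq0 norm_hnorm x1 oner_eq0.
Qed.

Lemma norm_dotp_pair_le2w (x y : H) : `|x| <= 1 -> `|y| <= 1 ->
  `|dotp (A x) y| + `|dotp (A y) x| <= (2 * w)%:C.
Proof.
move=> x1 y1; apply: le_trans (norm_dotp_pair_le x y) _.
rewrite mulrC rmorphM /= ler_wpM2r ?lecR ?numerical_radius_ge0//.
by rewrite rmorphD /= lerD// expr_le1.
Qed.

End NumericalRadius.

Lemma adjointP {R : realType} {H : hilbertType R} (A : H -> H) :
  (forall x y, dotp (A x) y = dotp x (adjoint A y)) \/ adjoint A = fun=> 0.
Proof.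
rewrite /adjoint; case: xgetP => [B _ AB|_]; last by right.
by left=> x y; apply: AB.
Qed.

Theorem theorem2p10 (R : realType) (H : hilbertType R)
    (A : {linear H -> H}) (hA : bounded_operator A) :
  let As := adjoint A in
  4^-1 * opnorm ((As \o A) \+ (A \o As))
    <= 8^-1 * (Num.max (opnorm (A \+ As) ^+ 2) (opnorm (A \- As) ^+ 2)
               + opnorm (A \+ As) * opnorm (A \- As))
  /\
  8^-1 * (Num.max (opnorm (A \+ As) ^+ 2) (opnorm (A \- As) ^+ 2)
          + opnorm (A \+ As) * opnorm (A \- As))
    <= numerical_radius A ^+ 2.
Proof.
move=> As; set w := numerical_radius A.
have w0 : 0 <= w := numerical_radius_ge0 _ hA.
(* An equality for a true adjoint and trivial for the zero default, so the bounds on b and d below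
   need no case split. *)
have le_As x y : `|dotp (As x) y| <= `|dotp (A y) x|.
  have [hAs|As0] := adjointP A; first by rewrite hAs norm_dotpC.
  by rewrite /As As0 norm_dotpC dotp0r normr0.
have hp x : `|x| <= 1 -> `|(A \+ As) x| <= (2 * w)%:C.
  move=> x1; apply: norm_le_of_dotp => y y1 /=; rewrite dotpDl.
  apply: le_trans (norm_dotp_pair_le2w _ hA _ _ x1 y1).
  by apply: le_trans (ler_normD _ _) _; rewrite lerD2l.
have hm x : `|x| <= 1 -> `|(A \- As) x| <= (2 * w)%:C.
  move=> x1; apply: norm_le_of_dotp => y y1 /=; rewrite dotpBl.
  apply: le_trans (norm_dotp_pair_le2w _ hA _ _ x1 y1).
  by apply: le_trans (ler_normB _ _) _; rewrite lerD2l.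
set b := opnorm (A \+ As); set d := opnorm (A \- As).
have b0 : 0 <= b := opnorm_ge0 _ _ hp.
have d0 : 0 <= d := opnorm_ge0 _ _ hm.
have b2w : b <= 2 * w := opnorm_le _ _ hp.
have d2w : d <= 2 * w := opnorm_le _ _ hm.
split; last first.
  (* The maximum and the product are each at most 4 w^2, and 8^-1 (4 + 4) = 1. *)
  have bd : b * d <= (2 * w) * (2 * w) by rewrite ler_pM.
  suff max4w : Num.max (b ^+ 2) (d ^+ 2) <= (2 * w) * (2 * w) by lra.
  by rewrite ge_max !expr2 !ler_pM.
(* The larger square is the maximum; the smaller one is at most b d. *)
have maxbd : b ^+ 2 + d ^+ 2 <= Num.max (b ^+ 2) (d ^+ 2) + b * d.
  have [bd|/ltW db] := leP b d.
    by rewrite max_r ?ler_sqr// addrC lerD2l expr2 ler_wpM2l.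
  by rewrite max_l ?ler_sqr// lerD2l expr2 ler_wpM2r.
suff opS : opnorm ((As \o A) \+ (A \o As)) <= 2^-1 * (b ^+ 2 + d ^+ 2) by lra.
apply: opnorm_le => x x1; have [hAs|As0] := adjointP A; last first.
  rewrite /As As0 /= linear0 addr0 normr0 lecR; nra.
apply: norm_le_of_dotp => y y1 /=.
have -> : dotp (As (A x) + A (As x)) y =
    2^-1 * (dotp ((A \+ As) x) ((A \+ As) y) + dotp ((A \- As) x) ((A \- As) y)).
  (* The mixed terms <A x, [As] y> and <[As] x, A y> cancel; moving [As] and [A] across the product
     identifies the rest. *)
  rewrite /= dotpBl !dotpBr !dotpDl !dotpDr.
  have -> : dotp (As (A x)) y = dotp (A x) (A y) by rewrite dotpC -hAs -dotpC.
  by have -> : dotp (A (As x)) y = dotp (As x) (As y) by []; field.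
have -> : (2^-1 * (b ^+ 2 + d ^+ 2))%:C = 2^-1 * (b%:C * b%:C + d%:C * d%:C).
  by rewrite !expr2 rmorphM rmorphD !rmorphM fmorphV rmorph_nat.
rewrite normrM normfV normr_nat ler_wpM2l ?invr_ge0//.
apply: le_trans (ler_normD _ _) (lerD _ _);
  apply: le_trans (dotp_Cauchy_Schwarz _ _) (ler_pM _ _ _ _) => //.
- exact: le_opnorm hp _ x1.
- exact: le_opnorm hp _ y1.
- exact: le_opnorm hm _ x1.
- exact: le_opnorm hm _ y1.
Qed.
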